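(* Let $\mathcal{C}$ be a bounded below graded poset and let $H:\mathcal{C}\to\mathrm{Ab}$ be a functor. If $H$ is pseudo-projective, then $H$ is $\varinjlim$-acyclic, i.e. $\varinjlim_j H=0$ for all $j\ge 1$.
   Context: A poset is regarded as a category with exactly one arrow $p\to p'$ when $p\le p'$ and none otherwise. For $p<p'$, $p$ precedes $p'$ if $p\le p''\le p'$ implies $p''=p$ or $p''=p'$. A graded poset is a poset together with an (increasing) degree function $\deg:\mathrm{Ob}(\mathcal{C})\to\mathbb{Z}$ which is strictly order preserving and such that $\deg(p')=\deg(p)+1$ whenever $p$ precedes $p'$. It is bounded below if the set of values of $\deg$ has a lower bound. The degree of an arrow $p\to p'$ is $|\deg(p')-\deg(p)|$. $\varinjlim_j:\mathrm{Ab}^{\mathcal{C}}\to\mathrm{Ab}$ is the $j$-th left derived functor of the colimit functor. For $H:\mathcal{C}\to\mathrm{Ab}$ and an object $i_0$, $\operatorname{Im}(i_0)\subseteq H(i_0)$ is the subgroup generated by the images of all $H(\alpha)$ with $\alpha:i\to i_0$, $\alpha\ne 1_{i_0}$ (it is $0$ if there is no such $\alpha$). $H$ is pseudo-projective if for every integer $d\ge 0$ the following holds: for any object $i_0$, any finite collection of pairwise different objects $i_1,\dots,i_k$, arrows $\alpha_j:i_j\to i_0$ with $\deg(\alpha_j)=d$ and elements $x_j\in H(i_j)$ ($j=1,\dots,k$) with $\sum_{j=1}^k H(\alpha_j)(x_j)=0$, we have $x_j\in\operatorname{Im}(i_j)$ for all $j=1,\dots,k$. *)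

(* Defs.v *)
From HB Require Import structures.
From mathcomp Require Import all_boot all_order all_algebra.
From mathcomp Require Import boolp.
From mathcomp Require Import freeg.

Set Implicit Arguments.
Unset Strict Implicit.
Unset Printing Implicit Defensive.

Import Order.TTheory GRing.Theory Num.Theory.

Local Open Scope ring_scope.
Local Open Scope quotient_scope.

(** Abelian groups are [zmodType]s and homomorphisms are [{additive A -> B}]. *)

Section AdditiveMaps.

Definition mk_additive (A B : zmodType) (f : A -> B) (fB : zmod_morphism f) :
    {additive A -> B} :=
  HB.pack f (GRing.isZmodMorphism.Build A B f fB).

Lemma zero_map_zmod_morphism (A B : zmodType) : zmod_morphism (fun _ : A => 0 : B).
Proof. by move=> x y; rewrite subr0. Qed.

Definition zero_map (A B : zmodType) : {additive A -> B} :=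
  mk_additive (@zero_map_zmod_morphism A B).

Lemma comp_zmod_morphism (A B C : zmodType) (g : {additive B -> C})
  (f : {additive A -> B}) : zmod_morphism (fun x => g (f x)).
Proof. by move=> x y; rewrite !raddfB. Qed.

Definition comp_map (A B C : zmodType) (g : {additive B -> C})
    (f : {additive A -> B}) : {additive A -> C} :=
  mk_additive (comp_zmod_morphism g f).

End AdditiveMaps.

Section Subgroups.
Variable A : zmodType.

Definition subgroup (K : A -> Prop) : Prop :=
  K 0 /\ forall x y, K x -> K y -> K (x - y).

Definition generated (S : A -> Prop) (x : A) : Prop :=
  forall K : A -> Prop, subgroup K -> (forall s, S s -> K s) -> K x.

Lemma generated_subgroup S : subgroup (generated S).
Proof.
split=> [K [K0 _] _|x y Sx Sy K sK SK] //.
by apply: sK.2; [apply: Sx|apply: Sy].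
Qed.

Lemma mem_generated (S : A -> Prop) x : S x -> generated S x.
Proof. by move=> Sx K _; apply. Qed.

End Subgroups.

Section Quotients.
Variables (A : zmodType) (S : A -> Prop).

Definition generatedb : pred A := fun x => `[< generated S x >].

Lemma generatedb_zmod_closed : zmod_closed generatedb.
Proof.
have [g0 gB] := generated_subgroup S.
split=> [|x y /asboolP Sx /asboolP Sy]; apply/asboolP => //.
exact: gB.
Qed.

Definition generated_closed : zmodClosed A :=
  HB.pack generatedb (GRing.isZmodClosed.Build A generatedb generatedb_zmod_closed).

(** The quotient of [A] by the subgroup generated by [S]. *)
Definition quotZ : zmodType := Quotient.quot generated_closed.

Lemma quot_pi_zmod_morphism :
  zmod_morphism (\pi_(Quotient.quot generated_closed) : A -> quotZ).
Proof. by move=> x y; rewrite raddfB. Qed.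

Definition quot_pi : {additive A -> quotZ} := mk_additive quot_pi_zmod_morphism.

Lemma quot_pi_surj (y : quotZ) : exists x, quot_pi x = y.
Proof. by exists (repr (y : Quotient.quot generated_closed)); exact: reprK. Qed.

Lemma quot_pi_eq0 x : quot_pi x = 0 <-> generated S x.
Proof.
rewrite -(raddf0 quot_pi); split=> [/eqP|Sx].
  by rewrite /= -Quotient.idealrBE subr0 => /asboolP.
by apply/eqP; rewrite /= -Quotient.idealrBE subr0; apply/asboolP.
Qed.

Section Descent.
Variables (B : zmodType) (f : {additive A -> B}).
Hypothesis fS : forall s, S s -> f s = 0.

Lemma generated_ker x : generated S x -> f x = 0.
Proof.
move=> /(_ (fun x => f x = 0)); apply=> //.
split=> [|y z fy fz]; first exact: raddf0.
by rewrite raddfB fy fz subr0.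
Qed.

Definition quot_desc_fun (y : quotZ) : B := f (repr (y : Quotient.quot generated_closed)).

Lemma quot_desc_funE x : quot_desc_fun (quot_pi x) = f x.
Proof.
apply/eqP; rewrite -subr_eq0 -raddfB; apply/eqP/generated_ker.
apply/quot_pi_eq0; rewrite raddfB; apply/eqP; rewrite subr_eq0; apply/eqP.
exact: reprK.
Qed.

Lemma quot_desc_zmod_morphism : zmod_morphism quot_desc_fun.
Proof.
move=> y z; have [u <-] := quot_pi_surj y; have [v <-] := quot_pi_surj z.
by rewrite -raddfB !quot_desc_funE raddfB.
Qed.

Definition quot_desc : {additive quotZ -> B} := mk_additive quot_desc_zmod_morphism.

Lemma quot_descE x : quot_desc (quot_pi x) = f x.
Proof. exact: quot_desc_funE. Qed.

End Descent.
End Quotients.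

Section Kernels.
Variables (A B : zmodType) (f : {additive A -> B}).

Definition kerb : pred A := fun x => f x == 0.

Lemma kerb_zmod_closed : zmod_closed kerb.
Proof.
split=> [|x y /eqP fx /eqP fy]; apply/eqP; first exact: raddf0.
by rewrite raddfB fx fy subr0.
Qed.

HB.instance Definition _ := GRing.isZmodClosed.Build A kerb kerb_zmod_closed.

Record ker_of := KerOf { ker_val : A; _ : kerb ker_val }.
HB.instance Definition _ := [isSub for ker_val].
HB.instance Definition _ := [Choice of ker_of by <:].
HB.instance Definition _ := [SubChoice_isSubZmodule of ker_of by <:].

Definition kerZ : zmodType := ker_of.

Lemma ker_val_zmod_morphism : zmod_morphism (ker_val : kerZ -> A).
Proof. exact: (raddfB (val : ker_of -> A)). Qed.

Definition ker_incl : {additive kerZ -> A} := mk_additive ker_val_zmod_morphism.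

Lemma ker_inclP (x : kerZ) : f (ker_incl x) = 0.
Proof. by case: x => x /= /eqP. Qed.

Lemma ker_incl_inj : injective ker_incl.
Proof. exact: val_inj. Qed.

Lemma ker_lift (x : A) : f x = 0 -> exists y, ker_incl y = x.
Proof. by move=> /eqP fx; exists (@KerOf x fx). Qed.

End Kernels.

(** Homology at [B] of [A -f-> B -g-> C]. *)
Definition homology (A B C : zmodType) (f : {additive A -> B})
    (g : {additive B -> C}) : zmodType :=
  @quotZ (kerZ g) (fun z => exists x, ker_incl g z = f x).

Section Functors.
Variables (disp : Order.disp_t) (C : porderType disp).

(** [p <= q] is a boolean, so a pair of comparable objects carries exactly one
    arrow; quantifying over all its proofs makes [fmap] independent of them. *)
Record functor := Functor {
  fobj :> C -> zmodType;
  fmap : forall p q : C, (p <= q)%O -> {additive fobj p -> fobj q};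
  fmap_id : forall (p : C) (le_pp : (p <= p)%O) x, fmap le_pp x = x;
  fmap_comp : forall (p q r : C) (le_pq : (p <= q)%O) (le_qr : (q <= r)%O)
    (le_pr : (p <= r)%O) x, fmap le_pr x = fmap le_qr (fmap le_pq x)
}.

Record nat_trans (H K : functor) := NatTrans {
  ntc :> forall p : C, {additive H p -> K p};
  nt_natural : forall (p q : C) (le_pq : (p <= q)%O) x,
    ntc q (fmap H le_pq x) = fmap K le_pq (ntc p x)
}.

Section Colimits.
Variable H : functor.

Record cocone (A : zmodType) := Cocone {
  leg :> forall p : C, {additive H p -> A};
  leg_fmap : forall (p q : C) (le_pq : (p <= q)%O) x,
    leg q (fmap H le_pq x) = leg p x
}.

Record colimit := Colimit {
  colim_obj :> zmodType;
  colim_in : cocone colim_obj;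
  colim_desc : forall A : zmodType, cocone A -> {additive colim_obj -> A};
  colim_descE : forall (A : zmodType) (c : cocone A) p x,
    colim_desc c (colim_in p x) = c p x;
  colim_desc_uniq : forall (A : zmodType) (c : cocone A)
    (u : {additive colim_obj -> A}),
    (forall p x, u (colim_in p x) = c p x) -> u =1 colim_desc c
}.

End Colimits.
End Functors.

Section FreeAbelianGroups.
Variables (T : choiceType) (A : zmodType) (f : T -> A).

Definition free_desc_fun (D : {freeg T}) : A := fglift (f : T -> zmodule A) D.

Lemma free_desc_zmod_morphism : zmod_morphism free_desc_fun.
Proof. exact: (lift_is_additive (f : T -> zmodule A)). Qed.

Definition free_desc : {additive {freeg T} -> A} :=
  mk_additive free_desc_zmod_morphism.

Lemma free_descE t : free_desc << t >> = f t.
Proof. by rewrite /= /free_desc_fun liftU scale1r. Qed.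

Lemma free_desc_uniq (u : {additive {freeg T} -> A}) :
  (forall t, u << t >> = f t) -> u =1 free_desc.
Proof.
move=> uE D; rewrite -(freeg_sumE D) !raddf_sum; apply: eq_bigr => t _.
have -> : << coeff t D *g t >> = << t >> *~ coeff t D :> {freeg T}.
  by rewrite freegU_mulz intz.
by rewrite !raddfMz uE free_descE.
Qed.

End FreeAbelianGroups.

Section ColimitConstruction.
Variables (disp : Order.disp_t) (C : porderType disp) (H : functor C).

(** The colimit is presented by one generator [x]_p for each [p] and [x] in
    [H p], subject to [x - y]_p = [x]_p - [y]_p and [H(p <= q)(x)]_q = [x]_p. *)
Local Notation generators := {p : C & H p}.
Local Notation gen p x :=
  (<< Tagged (fun p : C => H p : Type) (x : H p) >> : {freeg generators}).

Inductive colim_relation : {freeg generators} -> Prop :=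
| ColimAdd (p : C) (x y : H p) :
    colim_relation (gen p (x - y) - (gen p x - gen p y))
| ColimMap (p q : C) (le_pq : (p <= q)%O) (x : H p) :
    colim_relation (gen q (fmap H le_pq x) - gen p x).

Definition colim_carrier : zmodType := quotZ colim_relation.

Definition colim_in_fun (p : C) (x : H p) : colim_carrier :=
  quot_pi colim_relation (gen p x).

Lemma colim_in_zmod_morphism p : zmod_morphism (@colim_in_fun p).
Proof.
move=> x y; have /quot_pi_eq0 := mem_generated (ColimAdd x y).
by rewrite 2!raddfB => /eqP; rewrite subr_eq0 => /eqP.
Qed.

Lemma colim_in_fmap (p q : C) (le_pq : (p <= q)%O) x :
  mk_additive (@colim_in_zmod_morphism q) (fmap H le_pq x) =
  mk_additive (@colim_in_zmod_morphism p) x.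
Proof.
have /quot_pi_eq0 := mem_generated (ColimMap le_pq x).
by rewrite raddfB => /eqP; rewrite subr_eq0 => /eqP.
Qed.

Definition colim_cocone : cocone H colim_carrier := Cocone colim_in_fmap.

Section Universal.
Variables (A : zmodType) (c : cocone H A).

Definition colim_pre : {additive {freeg generators} -> A} :=
  free_desc (fun t : generators => c (tag t) (tagged t)).

Lemma colim_pre_relation s : colim_relation s -> colim_pre s = 0.
Proof.
case=> [p x y|p q le_pq x].
  by rewrite 2!raddfB !free_descE raddfB subrr.
by rewrite raddfB !free_descE leg_fmap subrr.
Qed.

Definition colim_carrier_desc : {additive colim_carrier -> A} :=
  quot_desc colim_pre_relation.

Lemma colim_carrier_descE p x : colim_carrier_desc (colim_cocone p x) = c p x.
Proof.
transitivity (colim_pre (gen p x)); first exact: quot_descE.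
exact: free_descE.
Qed.

Lemma colim_carrier_desc_uniq (u : {additive colim_carrier -> A}) :
  (forall p x, u (colim_cocone p x) = c p x) -> u =1 colim_carrier_desc.
Proof.
move=> uE y; have [D <-] := quot_pi_surj y; rewrite quot_descE.
rewrite -(free_desc_uniq (u := comp_map u (quot_pi _))) // => -[p x].
exact: uE.
Qed.

End Universal.

Definition colim : colimit H :=
  Colimit colim_carrier_descE colim_carrier_desc_uniq.

End ColimitConstruction.

Section ColimitFunctor.
Variables (disp : Order.disp_t) (C : porderType disp) (H K : functor C).
Variable f : nat_trans H K.

Lemma colim_map_leg (p q : C) (le_pq : (p <= q)%O) x :
  comp_map (colim_in (colim K) q) (f q) (fmap H le_pq x) =
  comp_map (colim_in (colim K) p) (f p) x.
Proof. by rewrite /= nt_natural; exact: (leg_fmap (colim_in (colim K))). Qed.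

Definition colim_map : {additive colim H -> colim K} :=
  colim_desc (colim H) (Cocone colim_map_leg).

Lemma colim_mapE p x :
  colim_map (colim_in (colim H) p x) = colim_in (colim K) p (f p x).
Proof. exact: colim_descE. Qed.

End ColimitFunctor.

Section DerivedColimit.
Variables (disp : Order.disp_t) (C : porderType disp).

(** Epimorphisms and exactness in the category of functors are pointwise. *)
Definition nt_epi (H K : functor C) (f : nat_trans H K) : Prop :=
  forall p y, exists x, f p x = y.

Definition nt_exact (H K L : functor C) (f : nat_trans H K)
    (g : nat_trans K L) : Prop :=
  forall p y, g p y = 0 <-> exists x, f p x = y.

Definition projective (P : functor C) : Prop :=
  forall (M N : functor C) (e : nat_trans M N) (f : nat_trans P N), nt_epi e ->
  exists g : nat_trans P M, forall p x, e p (g p x) = f p x.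

Record projective_resolution (H : functor C) := ProjectiveResolution {
  res :> nat -> functor C;
  res_d : forall n, nat_trans (res n.+1) (res n);
  res_aug : nat_trans (res 0%N) H;
  res_projective : forall n, projective (res n);
  res_aug_epi : nt_epi res_aug;
  res_exact0 : nt_exact (res_d 0%N) res_aug;
  res_exact : forall n, nt_exact (res_d n.+1) (res_d n)
}.

(** The [j]-th left derived functor of [colim] at [H], computed from [P]; up to
    isomorphism it does not depend on [P], and [free_resolution] below shows
    that such a [P] always exists. *)
Definition left_derived_colim (H : functor C) (P : projective_resolution H)
    (j : nat) : zmodType :=
  match j with
  | 0%N => homology (colim_map (res_d P 0%N)) (zero_map (colim (P 0%N)) (colim (P 0%N)))
  | n.+1 => homology (colim_map (res_d P n.+1)) (colim_map (res_d P n))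
  end.

Definition colim_acyclic (H : functor C) : Prop :=
  forall (P : projective_resolution H) (j : nat), (1 <= j)%N ->
  forall z : left_derived_colim P j, z = 0.

End DerivedColimit.

Section FreeResolution.
Variables (disp : Order.disp_t) (C : porderType disp).

Section FreeFunctor.
Variable H : functor C.

Local Notation elt q := {t : {p : C & H p} | (tag t <= q)%O}.

Definition elt_at (p q : C) (le_pq : (p <= q)%O) (x : H p) : elt q :=
  exist _ (Tagged (fun p : C => H p : Type) x) le_pq.

Definition free_fmap (q r : C) (le_qr : (q <= r)%O) :
    {additive {freeg elt q} -> {freeg elt r}} :=
  free_desc (fun t : elt q =>
    << elt_at (le_trans (valP t) le_qr) (tagged (val t)) >> : {freeg elt r}).

Lemma free_ext (T : choiceType) (A : zmodType) (u v : {additive {freeg T} -> A}) :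
  (forall t, u << t >> = v << t >>) -> u =1 v.
Proof.
by move=> uv D; rewrite (free_desc_uniq uv) -(free_desc_uniq (u := v) (fun=> erefl)).
Qed.

Lemma free_fmapE (p q r : C) (le_pq : (p <= q)%O) (le_qr : (q <= r)%O)
    (le_pr : (p <= r)%O) (x : H p) :
  free_fmap le_qr << elt_at le_pq x >> = << elt_at le_pr x >>.
Proof. by rewrite free_descE; congr << _ >>; exact: val_inj. Qed.

Lemma elt_atP (q : C) (t : elt q) :
  exists p (le_pq : (p <= q)%O) (x : H p), t = elt_at le_pq x.
Proof. by case: t => [[p x] le_pq]; exists p, le_pq, x. Qed.

Lemma free_fmap_id (p : C) (le_pp : (p <= p)%O) D : free_fmap le_pp D = D.
Proof.
apply: (free_ext (u := free_fmap le_pp) (v := idfun)) => t.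
by have [q [le_qp [x ->]]] := elt_atP t; rewrite (free_fmapE _ _ le_qp).
Qed.

Lemma free_fmap_comp (p q r : C) (le_pq : (p <= q)%O) (le_qr : (q <= r)%O)
  (le_pr : (p <= r)%O) D :
  free_fmap le_pr D = free_fmap le_qr (free_fmap le_pq D).
Proof.
apply: (free_ext (v := comp_map (free_fmap le_qr) (free_fmap le_pq))) => t.
have [o [le_op [x ->]]] := elt_atP t.
have le_or := le_trans le_op le_pr; have le_oq := le_trans le_op le_pq.
rewrite -[RHS]/(free_fmap le_qr (free_fmap le_pq _)).
by rewrite (free_fmapE _ _ le_or) (free_fmapE _ _ le_oq) (free_fmapE _ _ le_or).
Qed.

Definition free_functor : functor C := Functor free_fmap_id free_fmap_comp.

Definition free_cover_at (q : C) : {additive free_functor q -> H q} :=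
  free_desc (fun t : elt q => fmap H (valP t) (tagged (val t))).

Lemma free_cover_natural (q r : C) (le_qr : (q <= r)%O) D :
  free_cover_at r (fmap free_functor le_qr D) = fmap H le_qr (free_cover_at q D).
Proof.
apply: (free_ext (u := comp_map (free_cover_at r) (free_fmap le_qr))
  (v := comp_map (fmap H le_qr) (free_cover_at q))) => t.
have [p [le_pq [x ->]]] := elt_atP t; have le_pr := le_trans le_pq le_qr.
rewrite -[LHS]/(free_cover_at r (free_fmap le_qr _)).
rewrite -[RHS]/(fmap H le_qr (free_cover_at q _)).
by rewrite (free_fmapE _ _ le_pr) !free_descE; exact: fmap_comp.
Qed.

Definition free_cover : nat_trans free_functor H := NatTrans free_cover_natural.

Lemma free_cover_epi : nt_epi free_cover.
Proof.
move=> p x; exists << elt_at (lexx p) x >>.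
by rewrite -[LHS]/(free_cover_at p _) free_descE; exact: fmap_id.
Qed.

Lemma free_projective : projective free_functor.
Proof.
move=> M N e f eM.
pose l (t : {p : C & H p}) : M (tag t) :=
  sval (cid (eM (tag t) (f (tag t) << elt_at (lexx _) (tagged t) >>))).
have lE t : e (tag t) (l t) = f (tag t) << elt_at (lexx _) (tagged t) >>.
  by rewrite /l; case: cid.
pose g q : {additive free_functor q -> M q} :=
  free_desc (fun t : elt q => fmap M (valP t) (l (val t))).
have gN (q r : C) (le_qr : (q <= r)%O) D :
    g r (fmap free_functor le_qr D) = fmap M le_qr (g q D).
  apply: (free_ext (u := comp_map (g r) (free_fmap le_qr))
    (v := comp_map (fmap M le_qr) (g q))) => t.
  have [p [le_pq [x ->]]] := elt_atP t; have le_pr := le_trans le_pq le_qr.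
  rewrite -[LHS]/(g r (free_fmap le_qr _)) -[RHS]/(fmap M le_qr (g q _)).
  by rewrite (free_fmapE _ _ le_pr) !free_descE; exact: fmap_comp.
exists (NatTrans gN) => q D.
apply: (free_ext (u := comp_map (e q) (g q)) (v := f q)) => t.
have [p [le_pq [x ->]]] := elt_atP t.
rewrite -[LHS]/(e q (g q _)) free_descE nt_natural lE -nt_natural; congr (f q _).
exact: free_fmapE.
Qed.

End FreeFunctor.

Section KernelFunctor.
Variables (H K : functor C) (f : nat_trans H K).

Definition ker_fmap_fun (p q : C) (le_pq : (p <= q)%O) (x : kerZ (f p)) :
    kerZ (f q) :=
  @KerOf _ _ (f q) (fmap H le_pq (ker_incl _ x))
    (introT eqP (etrans (nt_natural f le_pq _)
      (etrans (congr1 (fmap K le_pq) (ker_inclP x)) (raddf0 _)))).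

Lemma ker_fmap_zmod_morphism p q (le_pq : (p <= q)%O) :
  zmod_morphism (ker_fmap_fun le_pq).
Proof.
move=> x y; apply: (@ker_incl_inj _ _ (f q)).
by rewrite [RHS]raddfB -[LHS]/(fmap H le_pq (ker_incl (f p) (x - y))) raddfB.
Qed.

Definition ker_fmap p q (le_pq : (p <= q)%O) :
    {additive kerZ (f p) -> kerZ (f q)} :=
  mk_additive (ker_fmap_zmod_morphism le_pq).

Lemma ker_fmap_id (p : C) (le_pp : (p <= p)%O) x : ker_fmap le_pp x = x.
Proof. by apply: (@ker_incl_inj _ _ (f p)); exact: fmap_id. Qed.

Lemma ker_fmap_comp (p q r : C) (le_pq : (p <= q)%O) (le_qr : (q <= r)%O)
  (le_pr : (p <= r)%O) x : ker_fmap le_pr x = ker_fmap le_qr (ker_fmap le_pq x).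
Proof. by apply: (@ker_incl_inj _ _ (f r)); exact: fmap_comp. Qed.

Definition ker_functor : functor C := Functor ker_fmap_id ker_fmap_comp.

Definition ker_functor_incl : nat_trans ker_functor H :=
  @NatTrans _ _ ker_functor H (fun p => ker_incl (f p)) (fun _ _ _ _ => erefl).

End KernelFunctor.

Lemma comp_natural (H K L : functor C) (g : nat_trans K L) (f : nat_trans H K)
    (p q : C) (le_pq : (p <= q)%O) x :
  comp_map (g q) (f q) (fmap H le_pq x) = fmap L le_pq (comp_map (g p) (f p) x).
Proof. by rewrite /= !nt_natural. Qed.

Definition comp_nt (H K L : functor C) (g : nat_trans K L) (f : nat_trans H K) :
  nat_trans H L := NatTrans (comp_natural g f).

Section Resolution.
Variable H : functor C.

Fixpoint syzygy (n : nat) : functor C :=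
  if n is m.+1 then ker_functor (free_cover (syzygy m)) else H.

Definition free_res_d n :
    nat_trans (free_functor (syzygy n.+1)) (free_functor (syzygy n)) :=
  comp_nt (ker_functor_incl (free_cover (syzygy n))) (free_cover (syzygy n.+1)).

Lemma free_res_exact (n : nat) :
  nt_exact (free_res_d n) (free_cover (syzygy n)).
Proof.
move=> p y; split=> [y0|[x <-]]; last exact: ker_inclP.
have [z <-] := ker_lift y0; have [x <-] := free_cover_epi (z : syzygy n.+1 p).
by exists x.
Qed.

Lemma free_res_exactS (n : nat) :
  nt_exact (free_res_d n.+1) (free_res_d n).
Proof.
move=> p y; rewrite -free_res_exact.
rewrite -[free_res_d n p y]/(ker_incl (free_cover (syzygy n) p)
  (free_cover (syzygy n.+1) p y)).
split=> [y0|yE].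
  by apply: (@ker_incl_inj _ _ (free_cover (syzygy n) p)); rewrite raddf0.
by rewrite [X in ker_incl _ X]yE raddf0.
Qed.

Definition free_resolution : projective_resolution H :=
  @ProjectiveResolution _ _ H (fun n => free_functor (syzygy n)) free_res_d
    (free_cover H) (fun n => @free_projective _) (@free_cover_epi H)
    (@free_res_exact 0%N) free_res_exactS.

End Resolution.
End FreeResolution.

Section GradedPosets.
Variables (disp : Order.disp_t) (C : porderType disp).

Definition precedes (p q : C) : Prop :=
  (p < q)%O /\ forall r : C, (p <= r)%O -> (r <= q)%O -> r = p \/ r = q.

Definition graded_poset (deg : C -> int) : Prop :=
  (forall p q : C, (p < q)%O -> deg p < deg q) /\
  (forall p q : C, precedes p q -> deg q = deg p + 1).

Definition bounded_below (deg : C -> int) : Prop :=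
  exists m : int, forall p : C, m <= deg p.

(** The degree of the arrow [p -> q]. *)
Definition arrow_deg (deg : C -> int) (p q : C) : nat := `|deg q - deg p|%N.

(** Since endomorphisms are identities, the arrows into [i0] other than the
    identity are the comparisons [i <= i0] with [i != i0]. *)
Definition Im (H : functor C) (i0 : C) : H i0 -> Prop :=
  generated (fun y => exists (i : C) (le_i : (i <= i0)%O) (x : H i),
    i <> i0 /\ y = fmap H le_i x).

Definition pseudo_projective (deg : C -> int) (H : functor C) : Prop :=
  forall (d : nat) (i0 : C) (k : nat) (i : 'I_k -> C)
    (alpha : forall j, (i j <= i0)%O) (x : forall j, H (i j)),
  injective i ->
  (forall j, arrow_deg deg (i j) i0 = d) ->
  \sum_(j < k) fmap H (alpha j) (x j) = 0 ->
  forall j, Im (x j).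

End GradedPosets.

(* Main.v *)
Require Import Defs.
From HB Require Import structures.
From mathcomp Require Import all_boot all_order all_algebra.
From mathcomp Require Import boolp freeg zify.

(** Dimension shifting reduces the claim to one fact: if [0 -> K -> P -> H -> 0]
    is exact with [P] and [H] pseudo-projective, then [K] is pseudo-projective
    and [colim K -> colim P] is injective; projective functors are
    pseudo-projective, being retracts of free ones.

    Since [deg] is bounded below, an element of [Im] at an object can be
    rewritten, one degree at a time, in terms of lower and lower objects. This
    gives, for a pseudo-projective [F], injectivity at every [q] of the map to
    [F q] from the colimit of [F] over the objects below [q], and also that the
    elements of [K q] lying in [Im] of [P] lie in [Im] of [K].
    Let [x] be a formal sum in [K] whose image in [P] is killed by relations
    landing in degree at most [n]. Comparing components in degree [n] shows that
    those of [x] lie in [Im] of [K], so [x] may be replaced by a sum supported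
    in degrees below [n]; by the injectivity below each [q], the image of the
    new sum is killed by relations landing in degrees below [n]. Induction on
    [n] ends at the lower bound. *)

Set Implicit Arguments.
Unset Strict Implicit.
Unset Printing Implicit Defensive.

Import Order.TTheory GRing.Theory Num.Theory.

Local Open Scope ring_scope.

(** * Direct sums of abelian groups *)

Section DirectSum.
Variables (I : choiceType) (F : I -> zmodType).

Local Notation gen i x :=
  (<< Tagged (fun i : I => F i : Type) (x : F i) >> : {freeg {i : I & F i}}).

Inductive dsum_relation : {freeg {i : I & F i}} -> Prop :=
| DsumAdd (i : I) (x y : F i) :
    dsum_relation (gen i (x - y) - (gen i x - gen i y)).

Definition dsum : zmodType := quotZ dsum_relation.

Definition dinj_fun (i : I) (x : F i) : dsum := quot_pi dsum_relation (gen i x).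

Lemma dinj_zmod_morphism i : zmod_morphism (@dinj_fun i).
Proof.
move=> x y; have /quot_pi_eq0 := mem_generated (DsumAdd x y).
by rewrite 2!raddfB => /eqP; rewrite subr_eq0 => /eqP.
Qed.

Definition dinj i : {additive F i -> dsum} := mk_additive (@dinj_zmod_morphism i).


Section Universal.
Variables (A : zmodType) (l : forall i, {additive F i -> A}).

Let pre : {additive {freeg {i : I & F i}} -> A} :=
  free_desc (fun t : {i : I & F i} => l (tag t) (tagged t)).

Lemma ddesc_relation s : dsum_relation s -> pre s = 0.
Proof. by case=> i x y; rewrite 2!raddfB !free_descE raddfB subrr. Qed.

Definition ddesc : {additive dsum -> A} := quot_desc ddesc_relation.

Lemma ddescE i x : ddesc (dinj i x) = l i x.
Proof.
transitivity (pre (gen i x)); first exact: quot_descE.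
exact: free_descE.
Qed.

End Universal.

Lemma dsum_ext (A : zmodType) (u v : {additive dsum -> A}) :
  (forall i x, u (dinj i x) = v (dinj i x)) -> u =1 v.
Proof.
move=> uv y; have [D <-] := quot_pi_surj y.
apply: (free_ext (u := comp_map u (quot_pi _)) (v := comp_map v (quot_pi _))).
by case=> i x; exact: uv.
Qed.

Definition dproj_leg (j i : I) : {additive F i -> F j} :=
  if i =P j is ReflectT e then
    ecast k {additive F i -> F k} e (idfun : {additive F i -> F i})
  else zero_map _ _.

Definition dproj j : {additive dsum -> F j} := ddesc (dproj_leg j).

Lemma dproj_id j x : dproj j (dinj j x) = x.
Proof.
by rewrite ddescE /dproj_leg; case: eqP => // e; rewrite (eq_axiomK e).
Qed.

Lemma dproj_neq i j x : i <> j -> dproj j (dinj i x) = 0.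
Proof. by move=> ij; rewrite ddescE /dproj_leg; case: eqP. Qed.

(** The quotient map modulo [K] agrees with zero on all generators, so it is zero, and its kernel is
    [K]. *)
Lemma dsum_ind (K : dsum -> Prop) :
  subgroup K -> (forall i x, K (dinj i x)) -> forall D, K D.
Proof.
move=> sK KI D; suff /quot_pi_eq0 /(_ K sK) KD : quot_pi K D = 0 by exact: KD.
rewrite -[RHS]/(zero_map dsum (quotZ K) D).
apply: dsum_ext => i x; apply/quot_pi_eq0; exact: mem_generated.
Qed.

Lemma dsum_expand D : exists s : seq I, uniq s /\
  D = \sum_(i <- s) dinj i (dproj i D).
Proof.
(* Allowing any larger duplicate-free list lets two sums be expanded over a common one. *)
suff [s sD] : exists s : seq I, forall s', uniq s' -> {subset s <= s'} ->
    D = \sum_(i <- s') dinj i (dproj i D).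
  exists (undup s); split; first exact: undup_uniq.
  by apply: sD => [|i]; [exact: undup_uniq|rewrite mem_undup].
elim/dsum_ind: D; [split=> [|D E [s sD] [t tE]]|move=> i x].
- by exists [::] => s' _ _; rewrite big1 // => i _; rewrite !raddf0.
- exists (s ++ t) => s' us' ss'.
  rewrite [in LHS](sD s') // => [|i si]; last by rewrite ss' // mem_cat si.
  rewrite [in LHS](tE s') // => [|i si]; last by rewrite ss' // mem_cat si orbT.
  by rewrite -sumrB; apply: eq_bigr => i _; rewrite !raddfB.
- exists [:: i] => s us ss; rewrite (bigD1_seq i) ?ss ?inE //.
  rewrite dproj_id big1 => [|j /eqP ji]; first exact: esym (addr0 _).
  by rewrite dproj_neq ?raddf0 // => /esym.
Qed.

Lemma dproj_inj D E : (forall i, dproj i D = dproj i E) -> D = E.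
Proof.
move=> DE; apply/eqP; rewrite -subr_eq0; apply/eqP.
have [s [_ ->]] := dsum_expand (D - E).
by rewrite big1 // => i _; rewrite raddfB DE subrr raddf0.
Qed.

(** As [r] is additive, partners picked arbitrarily for the components add up to a partner of
    [D]. *)
Lemma dsum_rel (T : zmodType) (r : dsum -> T -> Prop) D : r 0 0 ->
  (forall D E D' E', r D E -> r D' E' -> r (D + D') (E + E')) ->
  (forall i, exists E, r (dinj i (dproj i D)) E) -> exists E, r D E.
Proof.
move=> r0 rD rI; have [s [_ DE]] := dsum_expand D; rewrite [in r D]DE {DE}.
elim: s => [|i s [E rE]]; first by exists 0; rewrite big_nil.
have [E' rE'] := rI i; exists (E' + E); rewrite big_cons; exact: rD.
Qed.

Definition supp (U : I -> Prop) (D : dsum) : Prop :=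
  forall i, ~ U i -> dproj i D = 0.

Lemma supp0 U : supp U 0.
Proof. by move=> i _; rewrite raddf0. Qed.

Lemma suppD U D E : supp U D -> supp U E -> supp U (D + E).
Proof. by move=> UD UE i nU; rewrite raddfD UD ?UE ?addr0. Qed.

Lemma suppB U D E : supp U D -> supp U E -> supp U (D - E).
Proof. by move=> UD UE i nU; rewrite raddfB UD ?UE ?subr0. Qed.

Lemma supp_dinj (U : I -> Prop) i x : U i -> supp U (dinj i x).
Proof. by move=> Ui j nUj; apply: dproj_neq => ij; apply: nUj; rewrite -ij. Qed.

Lemma supp_sub (U V : I -> Prop) D :
  (forall i, U i -> V i) -> supp U D -> supp V D.
Proof. by move=> UV UD i nVi; apply: UD => /UV. Qed.

Lemma supp_ext (U : I -> Prop) (A : zmodType) (u v : {additive dsum -> A}) D :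
  (forall i x, U i -> u (dinj i x) = v (dinj i x)) -> supp U D -> u D = v D.
Proof.
move=> uv UD; have [s [_ ->]] := dsum_expand D; rewrite !raddf_sum.
apply: eq_bigr => i _; have [Ui|/UD ->] := pselect (U i); first exact: uv.
by rewrite !raddf0.
Qed.

Lemma supp_rel (U : I -> Prop) (T : zmodType) (r : dsum -> T -> Prop) D :
  r 0 0 ->
  (forall D E D' E', r D E -> r D' E' -> r (D + D') (E + E')) ->
  (forall i, U i -> exists E, r (dinj i (dproj i D)) E) ->
  supp U D -> exists E, r D E.
Proof.
move=> r0 rD rI UD; apply: dsum_rel => // i.
have [/rI //|/UD ->] := pselect (U i); exists 0; by rewrite raddf0.
Qed.

End DirectSum.

Section DirectSumMap.
Variables (I : choiceType) (F G : I -> zmodType).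
Variable f : forall i, {additive F i -> G i}.

Definition dmap : {additive dsum F -> dsum G} :=
  ddesc (fun i => comp_map (dinj G i) (f i)).

Lemma dmapE i x : dmap (dinj F i x) = dinj G i (f i x).
Proof. exact: ddescE. Qed.

Lemma dproj_dmap i D : dproj G i (dmap D) = f i (dproj F i D).
Proof.
apply: (dsum_ext (u := comp_map (dproj G i) dmap)
  (v := comp_map (f i) (dproj F i))) => j x.
rewrite -[LHS]/(dproj G i (dmap (dinj F j x))) dmapE.
rewrite -[RHS]/(f i (dproj F i (dinj F j x))).
have [ji|/eqP ji] := eqVneq j i; last by rewrite !dproj_neq // raddf0.
by case: i / ji; rewrite !dproj_id.
Qed.

Lemma supp_dmap U D : supp U D -> supp U (dmap D).
Proof. by move=> UD i nU; rewrite dproj_dmap UD // raddf0. Qed.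

Lemma dmap_surj (U : I -> Prop) E :
  (forall i, U i -> exists x, f i x = dproj G i E) -> supp U E ->
  exists2 D, supp U D & dmap D = E.
Proof.
move=> fU UE.
suff [D [UD DE]] : exists D, supp U D /\ dmap D = E by exists D.
apply: (supp_rel (r := fun E D => supp U D /\ dmap D = E)) UE.
- by split; [exact: supp0|exact: raddf0].
- by move=> E1 D1 E2 D2 [U1 <-] [U2 <-]; split; [exact: suppD|exact: raddfD].
- move=> i Ui; have [x xE] := fU i Ui.
  by exists (dinj F i x); split; [exact: supp_dinj|rewrite dmapE xE].
Qed.

End DirectSumMap.

Lemma generated_map (A B : zmodType) (f : {additive A -> B}) (S : A -> Prop)
    (T : B -> Prop) x :
  (forall s, S s -> generated T (f s)) -> generated S x -> generated T (f x).
Proof.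
move=> fS Sx; have [T0 TB] := generated_subgroup T.
apply: (Sx (fun x => generated T (f x))) => //; split; first by rewrite raddf0.
by move=> y z Ty Tz; rewrite raddfB; exact: TB.
Qed.

Lemma generated_sub (A : zmodType) (S T : A -> Prop) x :
  (forall s, S s -> T s) -> generated S x -> generated T x.
Proof. by move=> ST Sx K sK TK; apply: Sx => // s /ST /TK. Qed.

(** * Evaluation of formal sums in a functor *)

Section Evaluation.
Variables (disp : Order.disp_t) (C : porderType disp).

Section EvalDef.
Variable H : functor C.

(** The value zero on incomparable pairs makes the family total, so that [ev] is defined on all
    formal sums. *)
Definition push (p q : C) : {additive H p -> H q} :=
  if @idP (p <= q)%O is ReflectT le_pq then fmap H le_pq else zero_map _ _.

Lemma pushE (p q : C) (le_pq : (p <= q)%O) x : push p q x = fmap H le_pq x.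
Proof.
rewrite /push; case: {-}_ / idP => [h|//].
by rewrite (bool_irrelevance h le_pq).
Qed.

Lemma push_comp (p q r : C) x :
  (p <= q)%O -> (q <= r)%O -> push p r x = push q r (push p q x).
Proof.
move=> pq qr; rewrite (pushE pq) (pushE qr) (pushE (le_trans pq qr)).
exact: fmap_comp.
Qed.

Definition ev (q : C) : {additive dsum H -> H q} := ddesc (fun p => push p q).

Lemma evE q p x : ev q (dinj H p x) = push p q x.
Proof. exact: ddescE. Qed.

Lemma push_ev (p q : C) E : (p <= q)%O -> supp (fun r => (r < p)%O) E ->
  push p q (ev p E) = ev q E.
Proof.
move=> pq; apply: (supp_ext (u := comp_map (push p q) (ev p))) => r x rp.
rewrite -[LHS]/(push p q (ev p (dinj H r x))) !evE.
by rewrite -push_comp // ltW.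
Qed.

Lemma Im_subgroup p : subgroup (@Defs.Im _ _ H p).
Proof. exact: generated_subgroup. Qed.

Lemma Im_ev p E : supp (fun r => (r < p)%O) E -> Defs.Im (ev p E).
Proof.
have [I0 IB] := Im_subgroup p.
move=> UE; have [s [_ ->]] := dsum_expand E; rewrite raddf_sum.
elim/big_ind: _ => // [x y Ix Iy|r _].
  by rewrite -[y]opprK; apply: (IB) => //; rewrite -sub0r; apply: IB.
have [rp|/UE ->] := pselect (r < p)%O; last by rewrite !raddf0.
apply: mem_generated; exists r, (ltW rp), (dproj H r E).
by rewrite evE (pushE (ltW rp)); split=> // rE; rewrite rE ltxx in rp.
Qed.

End EvalDef.

Lemma push_natural (H K : functor C) (f : nat_trans H K) (p q : C) x :
  f q (push H p q x) = push K p q (f p x).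
Proof.
rewrite /push; case: {-}_ / idP => [h|_]; last exact: raddf0.
exact: nt_natural.
Qed.

Lemma ev_dmap (H K : functor C) (f : nat_trans H K) (q : C) D :
  ev K q (dmap f D) = f q (ev H q D).
Proof.
apply: (dsum_ext (u := comp_map (ev K q) (dmap f))
  (v := comp_map (f q) (ev H q))) => p x.
rewrite -[LHS]/(ev K q (dmap f (dinj H p x))) dmapE.
by rewrite -[RHS]/(f q (ev H q (dinj H p x))) !evE push_natural.
Qed.

Lemma Im_natural (H K : functor C) (f : nat_trans H K) (p : C) x :
  Defs.Im x -> Defs.Im (f p x).
Proof.
apply: generated_map => _ [i [le_i [y [ip ->]]]]; apply: mem_generated.
by exists i, le_i, (f i y); rewrite nt_natural.
Qed.

End Evaluation.

(** * Pseudo-projective functors on a bounded below graded poset *)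

Section PseudoProjective.
Variables (disp : Order.disp_t) (C : porderType disp) (deg : C -> int).
Hypothesis hgraded : graded_poset deg.
Variable lb : int.
Hypothesis lbP : forall p, lb <= deg p.

Lemma deg_lt (p q : C) : (p < q)%O -> deg p < deg q.
Proof. by case: hgraded => + _; exact. Qed.

(** If [p] does not precede [q], some element lies strictly between, and its degree gap to [q] is
    smaller; once [p] precedes [q], it serves as [r] itself. *)
Lemma pred_exists (p q : C) : (p < q)%O ->
  exists r, [/\ (p <= r)%O, (r < q)%O & deg r = deg q - 1].
Proof.
have [n] := ubnP `|deg q - deg p|%N.
elim: n p => // n IHn p qpn pq.
have [pq1|npq] := pselect (precedes p q).
  by exists p; rewrite lexx pq (hgraded.2 p q) // addrK.
have [r pr rq] : exists2 r, (p < r)%O & (r < q)%O.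
  apply: contrapT => nr; apply: npq; split=> // r pr rq.
  apply: contrapT => /not_orP[rp rq']; apply: nr; exists r; rewrite lt_neqAle.
    by rewrite pr andbT; apply/eqP => /esym.
  by rewrite rq andbT; apply/eqP.
have rq_deg := deg_lt rq; have pr_deg := deg_lt pr.
have [|s [rs sq sE]] := IHn r _ rq; first by lia.
by exists s; rewrite sq sE; split=> //; exact: le_trans (ltW pr) rs.
Qed.

Local Notation below q := (fun p : C => (p < q)%O).
Local Notation layer q e := (fun p : C => (p < q)%O /\ deg p = e).

(** By [pred_exists] every non-identity arrow into [q] factors through an object one degree below
    [q]. *)
Lemma Im_layer (H : functor C) (q : C) x : Defs.Im x ->
  exists E, supp (layer q (deg q - 1)) E /\ ev H q E = x.
Proof.
move=> /(_ (fun x => exists E, supp (layer q (deg q - 1)) E /\ ev H q E = x)).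
apply; first split.
- by exists 0; split; [exact: supp0|exact: raddf0].
- move=> _ _ [E [UE <-]] [E' [UE' <-]]; exists (E - E').
  by rewrite raddfB; split=> //; exact: suppB.
- move=> _ [p [le_pq [y [/eqP pq ->]]]].
  have {}pq : (p < q)%O by rewrite lt_neqAle pq.
  have [r [pr rq rE]] := pred_exists pq.
  exists (dinj H r (push H p r y)); split; first exact: supp_dinj.
  by rewrite evE -(push_comp _ pr (ltW rq)) (pushE le_pq).
Qed.

(** Pseudo-projectivity restated for formal sums: all components sit in degree [e], so their arrows
    to [q] share one degree. *)
Lemma pseudo_projective_ev (H : functor C) (q : C) (e : int) D :
  pseudo_projective deg H -> supp (fun p => (p <= q)%O /\ deg p = e) D ->
  ev H q D = 0 -> forall p, Defs.Im (dproj H p D).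
Proof.
move=> hH UD D0 p; have [s [us DE]] := dsum_expand D.
(* Only nonzero components are kept: for these the support condition gives an arrow to [q] from
   degree [e]. *)
pose t := [seq p <- s | dproj H p D != 0].
have tP i : i \in t -> (i <= q)%O /\ deg i = e.
  rewrite mem_filter => /andP[Di _]; apply: contrapT => /UD Di0.
  by rewrite Di0 eqxx in Di.
have DEt : D = \sum_(i <- t) dinj H i (dproj H i D).
  rewrite [LHS]DE big_filter [RHS]big_mkcond; apply: eq_bigr => i _.
  by case: eqP => [->|//]; rewrite raddf0.
have [pt|pt] := boolP (p \in t); last first.
  suff -> : dproj H p D = 0 by have [] := Im_subgroup H p.
  rewrite [in LHS]DEt raddf_sum big_seq big1 // => i it.
  by rewrite dproj_neq // => ip; rewrite -ip it in pt.
pose i (j : 'I_(size t)) := tnth (in_tuple t) j.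
have it j : i j \in t by exact: mem_tnth.
have jp : (index p t < size t)%N by rewrite index_mem.
have iE : i (Ordinal jp) = p.
  by rewrite /i (tnth_nth p) /= nth_index.
have := hH `|deg q - e|%N q (size t) i (fun j => (tP _ (it j)).1)
  (fun j => dproj H (i j) D) _ _ _ (Ordinal jp).
rewrite iE; apply.
- apply/injectiveP/dinjectiveP => j j' _ _; rewrite /i !(tnth_nth p) /= => jj'.
  by apply/val_inj/eqP; rewrite /=
    -(nth_uniq p (ltn_ord j) (ltn_ord j') (filter_uniq _ us)); apply/eqP.
- by move=> j; rewrite /arrow_deg (tP _ (it j)).2.
- rewrite -[RHS]D0 [in RHS]DEt raddf_sum (big_tnth _ _ t).
  by apply: eq_bigr => j _; rewrite evE (pushE (tP _ (it j)).1).
Qed.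

Lemma supp_layer0 (F : C -> zmodType) (U : C -> Prop) (D : dsum F) (e : int) :
  e < lb -> supp (fun p => U p /\ deg p = e) D -> D = 0.
Proof.
move=> elb UD; apply: dproj_inj => p; rewrite raddf0; apply: UD => -[_ pe].
by have := lbP p; rewrite pe leNgt elb.
Qed.

(** * Injectivity of the colimit below an object *)

Section LocalInjectivity.
Variables (H : functor C) (hH : pseudo_projective deg H) (A : zmodType).
Variables (q : C) (L : {additive dsum H -> A}).
Hypothesis L_push : forall (p r : C) x, (p < r)%O -> (r < q)%O ->
  L (dinj H r (push H p r x)) = L (dinj H p x).

Lemma L_ev (p : C) E : (p < q)%O -> supp (below p) E ->
  L (dinj H p (ev H p E)) = L E.
Proof.
move=> pq; apply: (supp_ext (u := comp_map L (comp_map (dinj H p) (ev H p)))).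
move=> r x rp; rewrite -[LHS]/(L (dinj H p (ev H p (dinj H r x)))) evE.
exact: L_push.
Qed.

(** Pseudo-projectivity puts every component in [Im], so it can be rewritten one degree lower with
    the same [ev H q] and the same [L], until the degree drops below [lb]. *)
Lemma layer_ev_eq0 (n : nat) (e : int) D : e < lb + n%:Z -> supp (layer q e) D ->
  ev H q D = 0 -> L D = 0.
Proof.
elim: n e D => [|n IHn] e D elb UD D0.
  by rewrite (supp_layer0 _ UD) ?raddf0 //; lia.
have ID : forall p, Defs.Im (dproj H p D).
  apply: (pseudo_projective_ev (q := q) (e := e) hH) => //.
  by apply: supp_sub UD => p [/ltW].
have [D' [UD' [evD' LD']]] : exists D', supp (layer q (e - 1)) D' /\
    (ev H q D' = ev H q D /\ L D' = L D).
  apply: (supp_rel (r := fun D D' => supp (layer q (e - 1)) D' /\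
    (ev H q D' = ev H q D /\ L D' = L D))) UD.
  - by rewrite !raddf0; split=> //; exact: supp0.
  - move=> E1 D1 E2 D2 [U1 [ev1 L1]] [U2 [ev2 L2]].
    by rewrite !raddfD ev1 L1 ev2 L2; split=> //; exact: suppD.
  - move=> p [pq pe]; have [E [UE EE]] := Im_layer (ID p); exists E.
    have UEp : supp (below p) E by apply: supp_sub UE => r [].
    rewrite evE -EE L_ev // (push_ev (ltW pq)) //; split=> //.
    apply: supp_sub UE => r [rp ->]; rewrite pe; split=> //.
    exact: lt_trans rp pq.
by rewrite -LD'; apply: (IHn (e - 1)); rewrite ?evD' //; lia.
Qed.

(** As [L] is any map compatible with the arrows below [q], this embeds the colimit over the objects
    below [q] in [H q]. Components are first pushed up to degree [deg q - 1], where [layer_ev_eq0]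
    applies. *)
Lemma below_ev_eq0 D : supp (below q) D -> ev H q D = 0 -> L D = 0.
Proof.
move=> UD D0.
have [D' [UD' [evD' LD']]] : exists D', supp (layer q (deg q - 1)) D' /\
    (ev H q D' = ev H q D /\ L D' = L D).
  apply: (supp_rel (r := fun D D' => supp (layer q (deg q - 1)) D' /\
    (ev H q D' = ev H q D /\ L D' = L D))) UD.
  - by rewrite !raddf0; split=> //; exact: supp0.
  - move=> E1 D1 E2 D2 [U1 [ev1 L1]] [U2 [ev2 L2]].
    by rewrite !raddfD ev1 L1 ev2 L2; split=> //; exact: suppD.
  - move=> p pq; have [r [pr rq rE]] := pred_exists pq.
    exists (dinj H r (push H p r (dproj H p D))); split; first exact: supp_dinj.
    rewrite !evE -(push_comp _ pr (ltW rq)); split=> //.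
    have [pr'|rp] := boolP (p < r)%O; first exact: L_push.
    have {}pr : p = r.
      by move: rp; rewrite lt_neqAle pr andbT negbK => /eqP.
    by case: r / pr {rq rE rp}; rewrite (pushE (lexx p)) fmap_id.
have dq : lb <= deg q by [].
rewrite -LD'; apply: (@layer_ev_eq0 `|deg q - lb|%N (deg q - 1)); rewrite ?evD' //.
by lia.
Qed.

End LocalInjectivity.

(** * Kernels of epimorphisms between pseudo-projective functors *)

Section ShortExact.
Variables (K P H : functor C) (f : nat_trans K P) (g : nat_trans P H).
Hypothesis f_inj : forall p, injective (f p).
Hypothesis fg_exact : nt_exact f g.
Hypothesis g_epi : nt_epi g.
Hypothesis hH : pseudo_projective deg H.

(** The components of the image of [Y] in [H] lie in [Im]. Their expressions one degree lower,
    lifted along [g], match the components of [Y] up to elements of [K]; these go into [X], and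
    induction treats the rest in degree [e - 1]. *)
Lemma layer_lift (n : nat) q (e : int) Y : e < lb + n%:Z -> supp (layer q e) Y ->
  g q (ev P q Y) = 0 ->
  exists X, supp (below q) X /\ f q (ev K q X) = ev P q Y.
Proof.
elim: n e Y => [|n IHn] e Y elb UY Y0.
  exists 0; split; first exact: supp0.
  by rewrite (supp_layer0 _ UY) ?raddf0 //; lia.
have IY : forall p, Defs.Im (dproj H p (dmap g Y)).
  apply: (pseudo_projective_ev (q := q) (e := e) hH); last by rewrite ev_dmap.
  by apply: supp_dmap; apply: supp_sub UY => p [/ltW].
have [[X Y'] [UX [UY' YE]]] : exists XY : (dsum K * dsum P)%type,
    supp (below q) XY.1 /\ (supp (layer q (e - 1)) XY.2 /\
    ev P q Y = f q (ev K q XY.1) + ev P q XY.2).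
  apply: (supp_rel (r := fun Y (XY : (dsum K * dsum P)%type) =>
    supp (below q) XY.1 /\ (supp (layer q (e - 1)) XY.2 /\
    ev P q Y = f q (ev K q XY.1) + ev P q XY.2))) UY.
  - split; [exact: supp0|split; first exact: supp0].
    by rewrite -[RHS]/(f q (ev K q 0) + ev P q 0) !raddf0 addr0.
  - move=> Y1 [X1 Z1] Y2 [X2 Z2] [U1 [V1 E1]] [U2 [V2 E2]].
    split; [exact: suppD|split; first exact: suppD].
    rewrite -[RHS]/(f q (ev K q (X1 + X2)) + ev P q (Z1 + Z2)).
    by rewrite !raddfD E1 E2 addrACA.
  - move=> p [pq pe]; have [E [UE EE]] := Im_layer (IY p).
    have [E' UE' E'E] := dmap_surj (f := g) (fun i _ => g_epi _) UE.
    have /fg_exact[k kE] : g p (dproj P p Y - ev P p E') = 0.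
      by rewrite raddfB -ev_dmap E'E EE dproj_dmap subrr.
    exists (dinj K p k, E'); split; [exact: supp_dinj|split].
      by apply: supp_sub UE' => r [rp ->]; rewrite pe; split=> //;
        exact: lt_trans rp pq.
    rewrite -[RHS]/(f q (ev K q (dinj K p k)) + ev P q E').
    rewrite !evE push_natural kE raddfB (push_ev (ltW pq)) ?subrK //.
    by apply: supp_sub UE' => r [].
have [] := IHn (e - 1) Y' _ UY'; first by lia.
  have gf0 : g q (f q (ev K q X)) = 0 by apply/fg_exact; exists (ev K q X).
  by move: Y0; rewrite YE raddfD gf0 add0r.
move=> X' [UX' X'E]; exists (X + X'); split; first exact: suppD.
by rewrite !raddfD X'E YE.
Qed.

(** [g] kills [f q x], so [layer_lift] applies to its expression in degree [deg q - 1]. With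
    [Im_ev], this shows that [Im] of [P] meets [K] inside [Im] of [K]. *)
Lemma Im_reflect q x : Defs.Im (f q x) ->
  exists X, supp (below q) X /\ ev K q X = x.
Proof.
move=> /Im_layer[Y [UY YE]].
have dq : lb <= deg q by [].
have [||X [UX XE]] := layer_lift (n := `|deg q - lb|%N) _ UY; first by lia.
  by rewrite YE; apply/fg_exact; exists x.
by exists X; split=> //; apply: f_inj; rewrite XE.
Qed.

Hypothesis hP : pseudo_projective deg P.

Lemma ker_pseudo_projective : pseudo_projective deg K.
Proof.
move=> d q k i alpha x i_inj i_deg x0 j.
suff /Im_reflect[X [UX <-]] : Defs.Im (f (i j) (x j)) by exact: Im_ev.
apply: (hP (alpha := alpha) (x := fun j => f (i j) (x j)) i_inj i_deg).
rewrite -[RHS](raddf0 (f q)) -x0 raddf_sum; apply: eq_bigr => j' _.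
by rewrite nt_natural.
Qed.

End ShortExact.
End PseudoProjective.

(** * Colimits as quotients of direct sums *)

Section ColimitPresentation.
Variables (disp : Order.disp_t) (C : porderType disp).

Section Relations.
Variable F : functor C.

(** [V] restricts the targets of the relations; it later bounds their degree for the induction. *)
Definition arrow_relation (V : C -> Prop) (E : dsum F) : Prop :=
  exists (p q : C) (x : F p), [/\ (p < q)%O, V q &
    E = dinj F q (push F p q x) - dinj F p x].

Lemma colim_ind (S : colim F -> Prop) : subgroup S ->
  (forall p x, S (colim_in (colim F) p x)) -> forall z, S z.
Proof.
move=> sS Sin z; suff /quot_pi_eq0 /(_ S sS) Sz : quot_pi S z = 0 by exact: Sz.
have S0 p q (le_pq : (p <= q)%O) x :
    zero_map (F q) (quotZ S) (fmap F le_pq x) = zero_map (F p) (quotZ S) x.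
  by [].
rewrite (colim_desc_uniq (c := Cocone S0) (u := quot_pi S)) => [|p x].
  symmetry; apply: (colim_desc_uniq (c := Cocone S0) (u := zero_map _ _)).
  by [].
by apply/quot_pi_eq0; exact: mem_generated.
Qed.

Definition colim_sum : {additive dsum F -> colim F} :=
  ddesc (fun p => colim_in (colim F) p).

Lemma colim_sumE p x : colim_sum (dinj F p x) = colim_in (colim F) p x.
Proof. exact: ddescE. Qed.

Lemma colim_sum_push (p q : C) x : (p < q)%O ->
  colim_sum (dinj F q (push F p q x)) = colim_sum (dinj F p x).
Proof.
by move=> pq; rewrite !colim_sumE (pushE (ltW pq)); exact: leg_fmap.
Qed.

Lemma colim_sum_surj z : exists D, colim_sum D = z.
Proof.
elim/colim_ind: z; first split.
- by exists 0; exact: raddf0.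
- by move=> _ _ [D <-] [E <-]; exists (D - E); exact: raddfB.
- by move=> p x; exists (dinj F p x); exact: colim_sumE.
Qed.

Lemma colim_sum_relation V E : generated (arrow_relation V) E -> colim_sum E = 0.
Proof.
move=> RE; apply: (generated_ker _ RE) => _ [p [q [x [pq _ ->]]]].
by rewrite raddfB colim_sum_push // subrr.
Qed.

(** The direct sum modulo the relations carries a cocone, whose induced map composed with
    [colim_sum] is the quotient map; so [D] dies in that quotient. *)
Lemma colim_sum_eq0 D :
  colim_sum D = 0 -> generated (arrow_relation (fun=> True)) D.
Proof.
move=> D0; set R := arrow_relation _.
have legP (p q : C) (le_pq : (p <= q)%O) x :
    comp_map (quot_pi R) (dinj F q) (fmap F le_pq x) =
    comp_map (quot_pi R) (dinj F p) x.
  have [pq|/eqP pq] := eqVneq p q.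
    by case: q / pq le_pq => le_pp; rewrite fmap_id.
  apply/eqP; rewrite -subr_eq0 -[X in X == 0](raddfB (quot_pi R)); apply/eqP.
  apply/quot_pi_eq0; apply: mem_generated; exists p, q, x; rewrite (pushE le_pq).
  by split=> //; rewrite lt_neqAle le_pq andbT; apply/eqP.
apply/quot_pi_eq0.
rewrite -(raddf0 (colim_desc (colim F) (Cocone legP))) -D0.
apply: (dsum_ext (v := comp_map (colim_desc (colim F) (Cocone legP)) colim_sum)).
move=> p x; rewrite -[RHS]/(colim_desc (colim F) (Cocone legP)
  (colim_sum (dinj F p x))) colim_sumE.
by rewrite (colim_descE (colim F) (Cocone legP)).
Qed.

End Relations.

Lemma colim_map_sum (F G : functor C) (f : nat_trans F G) D :
  colim_map f (colim_sum F D) = colim_sum G (dmap f D).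
Proof.
apply: (dsum_ext (u := comp_map (colim_map f) (colim_sum F))
  (v := comp_map (colim_sum G) (dmap f))) => p x.
rewrite -[LHS]/(colim_map f (colim_sum F (dinj F p x))).
rewrite -[RHS]/(colim_sum G (dmap f (dinj F p x))) dmapE !colim_sumE.
exact: colim_mapE.
Qed.

Lemma relation_lift (F G : functor C) (f : nat_trans F G) V E : nt_epi f ->
  generated (arrow_relation V) E ->
  exists D, generated (@arrow_relation F V) D /\ dmap f D = E.
Proof.
move=> f_epi; have [g0 gB] := generated_subgroup (@arrow_relation F V).
move=> /(_ (fun E => exists D, generated (@arrow_relation F V) D /\ dmap f D = E)).
apply; first split.
- by exists 0; split=> //; exact: raddf0.
- move=> _ _ [D [RD <-]] [D' [RD' <-]]; exists (D - D').
  by split; [exact: gB|exact: raddfB].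
- move=> _ [p [q [y [pq Vq ->]]]]; have [x <-] := f_epi p y.
  exists (dinj F q (push F p q x) - dinj F p x); split.
    by apply: mem_generated; exists p, q, x.
  by rewrite raddfB !dmapE push_natural.
Qed.

(** The relations killing the image of [D] lift to [G]. Subtracting the lift, which is zero in the
    colimit, leaves a sum whose components all map to zero, hence come from [F]. *)
Lemma colim_right_exact (F G K : functor C) (d : nat_trans F G)
    (e : nat_trans G K) z :
  nt_exact d e -> nt_epi e -> colim_map e z = 0 -> exists x, colim_map d x = z.
Proof.
move=> de_exact e_epi; have [D <-] := colim_sum_surj z.
rewrite colim_map_sum => /colim_sum_eq0 /(relation_lift e_epi)[E [RE EE]].
have [||X _ XE] := @dmap_surj _ _ _ d (fun=> True) (D - E).
- move=> p _; apply/de_exact.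
  by rewrite -dproj_dmap raddfB EE subrr raddf0.
- by move=> p [].
exists (colim_sum F X).
by rewrite colim_map_sum XE raddfB (colim_sum_relation RE) subr0.
Qed.

End ColimitPresentation.

Lemma subrACA (A : zmodType) (x y z t : A) : x - y - (z - t) = x - z - (y - t).
Proof. by rewrite opprD addrACA -opprD. Qed.

(** * Exchanging components for sums over lower objects *)

Section Excision.
Variables (disp : Order.disp_t) (C : porderType disp) (F : functor C).

Local Notation below q := (fun p : C => (p < q)%O).

(* For a family [Z] of formal sums [Z_q] below [q], [excise_top Z] is the sum of
   the values of the [Z_q] at [q] and [excise_low Z] the sum of the [Z_q]; the
   two agree in the colimit. *)
Definition excise_top : {additive dsum (fun=> dsum F) -> dsum F} :=
  ddesc (fun q : C => comp_map (dinj F q) (ev F q)).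

Definition excise_low : {additive dsum (fun=> dsum F) -> dsum F} :=
  ddesc (fun q : C => idfun : {additive dsum F -> dsum F}).

Lemma excise_top_inj q Y : excise_top (dinj _ q Y) = dinj F q (ev F q Y).
Proof. exact: ddescE. Qed.

Lemma dproj_top q Z : dproj F q (excise_top Z) = ev F q (dproj _ q Z).
Proof.
apply: (dsum_ext (u := comp_map (dproj F q) excise_top)
  (v := comp_map (ev F q) (dproj _ q))) => p Y.
rewrite -[LHS]/(dproj F q (excise_top (dinj _ p Y))) excise_top_inj.
rewrite -[RHS]/(ev F q (dproj _ q (dinj _ p Y))).
have [pq|/eqP pq] := eqVneq p q; last by rewrite !dproj_neq // raddf0.
by case: q / pq; rewrite !dproj_id.
Qed.

Lemma excise_low_inj q Y : excise_low (dinj _ q Y) = Y.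
Proof. exact: ddescE. Qed.

Definition lower (U : C -> Prop) (Z : dsum (fun _ : C => dsum F)) : Prop :=
  supp U Z /\ forall q, supp (below q) (dproj _ q Z).

Lemma lower0 U : lower U 0.
Proof. by split=> [|q]; rewrite ?raddf0; exact: supp0. Qed.

Lemma lowerD U Z Z' : lower U Z -> lower U Z' -> lower U (Z + Z').
Proof.
move=> [UZ bZ] [UZ' bZ']; split=> [|q]; first exact: suppD.
by rewrite raddfD; exact: suppD.
Qed.

Lemma lowerB U Z Z' : lower U Z -> lower U Z' -> lower U (Z - Z').
Proof.
move=> [UZ bZ] [UZ' bZ']; split=> [|q]; first exact: suppB.
by rewrite raddfB; exact: suppB.
Qed.

Lemma lower_inj (U : C -> Prop) q Y : U q -> supp (below q) Y -> lower U (dinj _ q Y).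
Proof.
move=> Uq bY; split=> [|p]; first exact: supp_dinj.
have [qp|/eqP qp] := eqVneq q p; last by rewrite dproj_neq //; exact: supp0.
by case: p / qp; rewrite dproj_id.
Qed.

Lemma excise_low_ind U (S : dsum F -> Prop) Z : lower U Z -> S 0 ->
  (forall D E, S D -> S E -> S (D + E)) ->
  (forall q, U q -> S (dproj _ q Z)) -> S (excise_low Z).
Proof.
move=> [UZ _] S0 SD SU; have [s [_ ->]] := dsum_expand Z; rewrite raddf_sum.
elim/big_ind: _ => // q _; rewrite excise_low_inj.
by have [/SU //|/UZ ->] := pselect (U q).
Qed.

Lemma excise_eq U (A : zmodType) (L : {additive dsum F -> A}) Z :
  (forall (p q : C) x, (p < q)%O -> U q ->
    L (dinj F q (push F p q x)) = L (dinj F p x)) ->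
  lower U Z -> L (excise_top Z) = L (excise_low Z).
Proof.
move=> LP [UZ bZ]; have [s [_ ->]] := dsum_expand Z; rewrite !raddf_sum.
apply: eq_bigr => q _; rewrite excise_low_inj excise_top_inj.
have [Uq|/UZ ->] := pselect (U q); last by rewrite !raddf0.
rewrite -[LHS]/(comp_map L (comp_map (dinj F q) (ev F q)) (dproj _ q Z)).
apply: supp_ext (bZ q) => p x pq.
rewrite -[LHS]/(L (dinj F q (ev F q (dinj F p x)))) evE; exact: LP.
Qed.

End Excision.

Lemma excise_top_natural (disp : Order.disp_t) (C : porderType disp)
    (F G : functor C) (f : nat_trans F G) Z :
  excise_top G (dmap (fun _ : C => dmap f) Z) = dmap f (excise_top F Z).
Proof.
by apply: dproj_inj => q; rewrite dproj_dmap !dproj_top dproj_dmap ev_dmap.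
Qed.

Lemma excise_low_natural (disp : Order.disp_t) (C : porderType disp)
    (F G : functor C) (f : nat_trans F G) Z :
  excise_low G (dmap (fun _ : C => dmap f) Z) = dmap f (excise_low F Z).
Proof.
apply: (dsum_ext (u := comp_map (excise_low G) (dmap (fun _ : C => dmap f)))
  (v := comp_map (dmap f) (excise_low F))) => q Y.
transitivity (dmap f Y); last
  by congr (dmap f _); rewrite -[LHS](@excise_low_inj _ _ F q Y).
rewrite -[RHS](@excise_low_inj _ _ G q (dmap f Y))
  -(dmapE (fun _ : C => dmap f)); reflexivity.
Qed.

Lemma lower_dmap (disp : Order.disp_t) (C : porderType disp)
    (F G : functor C) (f : nat_trans F G) U Z :
  lower U Z -> lower U (dmap (fun _ : C => dmap f) Z).
Proof.
move=> [UZ bZ]; split=> [|q]; first exact: supp_dmap.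
by rewrite dproj_dmap; exact: supp_dmap.
Qed.

(** * Injectivity of colimits of kernels *)

Section Tiers.
Variables (disp : Order.disp_t) (C : porderType disp) (deg : C -> int).
Hypothesis hgraded : graded_poset deg.
Variable lb : int.
Hypothesis lbP : forall p, lb <= deg p.

Local Notation below q := (fun p : C => (p < q)%O).

(** The final induction runs over this filtration: [tier 0] is empty by the lower bound, and
    [tier n.+1] adds [stratum n] to [tier n]. *)
Definition tier (n : nat) (p : C) : Prop := deg p < lb + n%:Z.
Definition stratum (n : nat) (p : C) : Prop := deg p = lb + n%:Z.

Lemma tierS n p : tier n.+1 p -> ~ tier n p -> stratum n p.
Proof. by rewrite /tier /stratum; lia. Qed.

Lemma below_stratum n (p q : C) : (p < q)%O -> stratum n q -> tier n p.
Proof. by move=> /(deg_lt hgraded) + qn; rewrite /tier -qn. Qed.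

Lemma stratum_tier n p : stratum n p -> ~ tier n p.
Proof. by rewrite /stratum /tier => ->; rewrite ltxx. Qed.

Lemma tier_le (m n : nat) p : (m <= n)%N -> tier m p -> tier n p.
Proof. by rewrite /tier; lia. Qed.

(** * Relations filtered by the degree of their targets *)

Section Functor.
Variable F : functor C.

Lemma relation_tier E : generated (@arrow_relation _ _ F (fun=> True)) E ->
  exists n, generated (@arrow_relation _ _ F (tier n)) E.
Proof.
have mono (m n : nat) D : (m <= n)%N -> generated (@arrow_relation _ _ F (tier m)) D ->
    generated (@arrow_relation _ _ F (tier n)) D.
  move=> mn; apply: generated_sub => _ [p [q [x [pq qm ->]]]].
  by exists p, q, x; split=> //; exact: tier_le qm.
move=> /(_ (fun E => exists n, generated (@arrow_relation _ _ F (tier n)) E)).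
apply; first split.
- by exists 0%N; have [] := generated_subgroup (@arrow_relation _ _ F (tier 0)).
- move=> D E' [m RD] [n RE]; exists (maxn m n).
  have [_ gB] := generated_subgroup (@arrow_relation _ _ F (tier (maxn m n))).
  by apply: gB; [apply: mono RD|apply: mono RE]; rewrite ?leq_maxl ?leq_maxr.
- move=> D [p [q [x [pq _ DE]]]]; exists `|deg q - lb|.+1%N.
  apply: mem_generated; exists p, q, x; split=> //.
  by have := lbP q; rewrite /tier; lia.
Qed.

Lemma supp_tier (D : dsum F) : exists n, supp (tier n) D.
Proof.
elim/dsum_ind: D; first split.
- by exists 0%N; exact: supp0.
- move=> D E [m UD] [n UE]; exists (maxn m n); apply: suppB.
    by apply: supp_sub UD => p; apply: tier_le; rewrite leq_maxl.
  by apply: supp_sub UE => p; apply: tier_le; rewrite leq_maxr.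
- move=> p x; exists `|deg p - lb|.+1%N; apply: supp_dinj.
  by have := lbP p; rewrite /tier; lia.
Qed.

Lemma supp_relation n E : generated (@arrow_relation _ _ F (tier n)) E ->
  supp (tier n) E.
Proof.
move=> /(_ (supp (tier n))); apply.
  by split=> [|D D']; [exact: supp0|exact: suppB].
move=> _ [p [q [x [pq qn ->]]]]; apply: suppB; apply: supp_dinj => //.
exact: lt_trans (deg_lt hgraded pq) qn.
Qed.

Lemma supp_excise_low n Z : lower (stratum n) Z ->
  supp (tier n) (excise_low F Z).
Proof.
move=> lZ; apply: (excise_low_ind lZ); [exact: supp0|exact: suppD|].
move=> q qn; apply: supp_sub (lZ.2 q) => p pq; exact: below_stratum pq qn.
Qed.

(** A relation with target in degree [lb + n] is itself an excision difference, for the family whose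
    only entry is its source; [Z] collects these, and the other relations have lower targets. *)
Lemma relation_excise n E :
  generated (@arrow_relation _ _ F (tier n.+1)) E ->
  exists Z, lower (stratum n) Z /\
    generated (@arrow_relation _ _ F (tier n)) (E - (excise_top F Z - excise_low F Z)).
Proof.
set R := @arrow_relation _ _ F (tier n).
have [g0 gB] := generated_subgroup R.
move=> /(_ (fun E => exists Z, lower (stratum n) Z /\
  generated R (E - (excise_top F Z - excise_low F Z)))).
apply; first split.
- exists 0; split; first exact: lower0.
  by rewrite (raddf0 (excise_top F)) (raddf0 (excise_low F)) !subr0.
- move=> D E' [Z [lZ RZ]] [Z' [lZ' RZ']]; exists (Z - Z').
  split; first exact: lowerB.
  have := gB _ _ RZ RZ'; congr (generated R _); rewrite subrACA; congr (_ - _).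
  by rewrite subrACA -!raddfB.
- move=> _ [p [q [x [pq qn ->]]]].
  have [qn'|/(tierS qn) qn'] := pselect (tier n q).
    exists 0; split; first exact: lower0.
    rewrite (raddf0 (excise_top F)) (raddf0 (excise_low F)) !subr0.
    by apply: mem_generated; exists p, q, x.
  exists (dinj _ q (dinj F p x)).
  split; first by apply: lower_inj => //; exact: supp_dinj.
  by rewrite excise_low_inj excise_top_inj evE subrr.
Qed.

(** Components at different objects are independent, so each member of [Z] evaluates to zero at its
    index [q]. Injectivity below [q], with [L] the quotient map by the relations of [tier n], does
    the rest. *)
Lemma excise_functional n Z : pseudo_projective deg F ->
  lower (stratum n) Z -> excise_top F Z = 0 ->
  generated (@arrow_relation _ _ F (tier n)) (excise_low F Z).
Proof.
move=> hF lZ Z0; set R := arrow_relation _.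
have [g0 gB] := generated_subgroup R.
apply: (excise_low_ind lZ) => // [D E RD RE|q qn].
  by rewrite -[E]opprK; apply: (gB) => //; rewrite -sub0r; exact: gB.
apply/quot_pi_eq0; apply: (below_ev_eq0 hgraded lbP hF (q := q)).
- move=> p r x pr rq; apply/eqP; rewrite -subr_eq0 -raddfB; apply/eqP.
  apply/quot_pi_eq0; apply: mem_generated; exists p, r, x; split=> //.
  exact: below_stratum rq qn.
- exact: lZ.2.
- by rewrite -dproj_top Z0 raddf0.
Qed.

End Functor.

(** * Removing the top degree from a formal sum *)

Section Injectivity.
Variables (K P H : functor C) (f : nat_trans K P) (g : nat_trans P H).
Hypothesis f_inj : forall p, injective (f p).
Hypothesis fg_exact : nt_exact f g.
Hypothesis g_epi : nt_epi g.
Hypothesis hH : pseudo_projective deg H.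
Hypothesis hP : pseudo_projective deg P.

Lemma tier_inj n D : supp (tier n) D ->
  generated (@arrow_relation _ _ P (tier n)) (dmap f D) -> colim_sum K D = 0.
Proof.
elim: n D => [|n IHn] D UD RD.
  suff -> : D = 0 by exact: raddf0.
  apply: dproj_inj => p; rewrite raddf0; apply: UD.
  by have := lbP p; rewrite /tier addr0 leNgt => /negP.
have [Z [lZ RZ]] := relation_excise RD.
(* In degree [lb + n] the remaining relations and [excise_low] have no components, so [excise_top]
   alone matches [dmap f D]. *)
have topZ q : stratum n q -> f q (dproj K q D) = ev P q (dproj _ q Z).
  move=> /stratum_tier qn; have := supp_relation RZ qn.
  rewrite 2!raddfB (supp_excise_low lZ qn) subr0 dproj_dmap dproj_top.
  by move/eqP; rewrite subr_eq0 => /eqP.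
(* By [topZ] the top components of [D] map into [Im] of [P], so [Im_reflect] writes them as sums in
   [K] from below; [V] gathers these sums. *)
have [V [lV VD]] : exists V, lower (stratum n) V /\
    (forall q, stratum n q -> dproj K q D = dproj K q (excise_top K V)).
  apply: (supp_rel (r := fun D V => lower (stratum n) V /\
    (forall q, stratum n q -> dproj K q D = dproj K q (excise_top K V)))) UD.
  - by split=> [|q _]; [exact: lower0|rewrite !raddf0].
  - move=> D1 V1 D2 V2 [l1 E1] [l2 E2]; split=> [|q qn]; first exact: lowerD.
    by rewrite !raddfD E1 ?E2.
  - move=> p pn.
    have [pn'|/(tierS pn) pn'] := pselect (tier n p).
      exists 0; split=> [|q qn]; first exact: lower0.
      by rewrite !raddf0 dproj_neq // => pq; apply: (stratum_tier qn); rewrite -pq.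
    have [] := @Im_reflect _ _ _ hgraded _ lbP _ _ _ f g f_inj fg_exact g_epi hH p
      (dproj K p D).
      by rewrite topZ //; apply: Im_ev; exact: lZ.2.
    move=> X [UX XE]; exists (dinj _ p X); split; first exact: lower_inj.
    by move=> q _; rewrite excise_top_inj XE.
set D' := D - (excise_top K V - excise_low K V).
have DD' : colim_sum K D' = colim_sum K D.
  have eqV : colim_sum K (excise_top K V) = colim_sum K (excise_low K V).
    by apply: excise_eq lV => p q x pq _; exact: colim_sum_push.
  by rewrite 2!raddfB eqV subrr subr0.
rewrite -DD'; apply: IHn => [q qn|].
  rewrite 2!raddfB (supp_excise_low lV qn) subr0.
  have [/tierS/(_ qn) qn'|qn'] := pselect (tier n.+1 q).
    by rewrite VD // subrr.
  rewrite UD // dproj_top lV.1 ?raddf0 ?addr0 //.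
  by move: qn'; rewrite /tier /stratum => + h; rewrite h; apply; lia.
set V' := dmap (fun _ : C => dmap f) V.
have lV' : lower (stratum n) V' by exact: lower_dmap.
have fD' : dmap f D' = dmap f D - (excise_top P V' - excise_low P V').
  by rewrite 2!raddfB excise_top_natural excise_low_natural.
(* Both families have the top components of [dmap f D] as values, so by [excise_functional] their
   low sums differ by relations of [tier n]. *)
have top0 : excise_top P (Z - V') = 0.
  apply: dproj_inj => q; rewrite raddf0 dproj_top.
  have [qn|qn] := pselect (stratum n q); last first.
    by rewrite raddfB lZ.1 // lV'.1 // subrr raddf0.
  rewrite 2!raddfB -topZ // VD // -dproj_top excise_top_natural dproj_dmap.
  by rewrite subrr.
have low0 := excise_functional hP (lowerB lZ lV') top0.
have [_ gB] := generated_subgroup (@arrow_relation _ _ P (tier n)).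
have topE : excise_top P Z = excise_top P V'.
  by apply/eqP; rewrite -subr_eq0 -raddfB top0.
have := gB _ _ RZ low0; rewrite fD' topE (raddfB (excise_low P)).
by rewrite -addrA -opprD addrA subrK.
Qed.

Lemma colim_map_injective z : colim_map f z = 0 -> z = 0.
Proof.
have [D <-] := colim_sum_surj z; rewrite colim_map_sum.
move=> /colim_sum_eq0 /relation_tier[m RD]; have [n UD] := supp_tier D.
apply: (@tier_inj (maxn m n)).
  by apply: supp_sub UD => p; apply: tier_le; rewrite leq_maxr.
apply: generated_sub RD => _ [p [q [x [pq qm ->]]]]; exists p, q, x; split=> //.
by apply: tier_le qm; rewrite leq_maxl.
Qed.

End Injectivity.
End Tiers.

(** * Resolutions *)

Section Acyclicity.
Variables (disp : Order.disp_t) (C : porderType disp) (deg : C -> int).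
Hypothesis hgraded : graded_poset deg.

Local Notation elt H q := {t : {p : C & H p : Type} | (tag t <= q)%O}.

(** The free functor at [q] has as basis the pairs tagged by some [p <= q], and arrows include
    bases. [tau] keeps the basis elements tagged [i j]: modulo [Im] it inverts the map along
    [alpha j], and it kills the other terms of the sum. *)
Lemma free_pseudo_projective (H : functor C) :
  pseudo_projective deg (free_functor H).
Proof.
move=> d q k i alpha x i_inj i_deg x0 j; set F := free_functor H in x x0 *.
pose tau : {additive {freeg elt H q} -> F (i j)} :=
  free_desc (fun t : elt H q => if tag (val t) == i j then
    oapp (fun u : elt H (i j) => << u >> : {freeg elt H (i j)}) 0
      (insub (val t)) else 0).
have tau0 j' y : j' != j -> tau (fmap F (alpha j') y) = 0.
  move=> j'j.
  apply: (free_ext (u := comp_map tau (fmap F (alpha j'))) (v := zero_map _ _)).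
  move=> t; have [p [le_p [h ->]]] := elt_atP t.
  rewrite -[LHS]/(tau (free_fmap H (alpha j') << elt_at le_p h >>)).
  rewrite (free_fmapE _ _ (le_trans le_p (alpha j'))) free_descE.
  case: eqP => // pj; exfalso; have {}pj : p = i j := pj.
  move: le_p j'j; rewrite pj le_eqVlt => /predU1P[/i_inj ->|].
    by rewrite eqxx.
  move=> /(deg_lt hgraded) ij _.
  (* As both objects lie below [q], equal arrow degrees mean equal degrees, which contradicts
     [i j < i j']. *)
  have le_deg j0 : deg (i j0) <= deg q.
    by have := alpha j0; rewrite le_eqVlt => /predU1P[->//|/(deg_lt hgraded)/ltW].
  have := i_deg j; have := i_deg j'; rewrite /arrow_deg.
  by have := le_deg j; have := le_deg j'; lia.
have [I0 IB] := Im_subgroup F (i j).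
have ImE y : Defs.Im (y - tau (fmap F (alpha j) y)).
  suff /quot_pi_eq0 ImE :
      quot_pi (@Defs.Im _ _ F (i j)) (y - tau (fmap F (alpha j) y)) = 0.
    by apply: ImE.
  rewrite raddfB; apply/eqP; rewrite subr_eq0; apply/eqP; move: y.
  apply: (free_ext (u := quot_pi (@Defs.Im _ _ F (i j)))
    (v := comp_map (quot_pi _) (comp_map tau (fmap F (alpha j))))) => t.
  have [p [le_p [h ->]]] := elt_atP t.
  rewrite -[RHS]/(quot_pi _ (tau (free_fmap H (alpha j) << elt_at le_p h >>))).
  rewrite (free_fmapE _ _ (le_trans le_p (alpha j))) free_descE /=.
  case: eqP => [pj|pj].
    by rewrite (@insubT _ _ (elt H (i j)) (Tagged (fun p : C => H p : Type) h) le_p).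
  (* A basis element tagged [p] other than [i j] comes along [p < i j]. The quotient is by the
     subgroup generated by [Im], itself a generated subgroup, hence two memberships. *)
  rewrite raddf0; apply/quot_pi_eq0; apply: mem_generated; apply: mem_generated.
  exists p, le_p, << elt_at (lexx p) h >>; split=> //.
  by rewrite -(free_fmapE (lexx p) le_p).
have := ImE (x j); congr (Defs.Im _).
suff -> : tau (fmap F (alpha j) (x j)) = 0 by rewrite subr0.
rewrite -[RHS](raddf0 tau) -x0 raddf_sum (bigD1 j) //= big1 ?addr0 //.
by move=> j' j'j; exact: tau0.
Qed.

(** Lifting the identity of [P] along its free cover makes [P] a retract of a free functor; the
    section carries relations over, and [Im] comes back by naturality. *)
Lemma projective_pseudo_projective (P : functor C) :
  projective P -> pseudo_projective deg P.
Proof.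
move=> hP d q k i alpha x i_inj i_deg x0 j.
have id_nat (p r : C) (le_pr : (p <= r)%O) (y : P p) :
    (idfun : {additive P r -> P r}) (fmap P le_pr y) =
    fmap P le_pr ((idfun : {additive P p -> P p}) y) by [].
have [s sE] := hP _ _ _ (NatTrans id_nat) (@free_cover_epi _ _ P).
have -> : x j = free_cover P (i j) (s (i j) (x j)) by rewrite sE.
apply: Im_natural.
apply: (free_pseudo_projective (alpha := alpha)
  (x := fun j => s (i j) (x j)) i_inj i_deg).
rewrite -[RHS](raddf0 (s q)) -x0 raddf_sum; apply: eq_bigr => j' _.
by rewrite nt_natural.
Qed.

(** Exactness gives values in the kernel; they are unique since the kernel embeds, so the choice is
    additive and natural. *)
Lemma corestrict (F G H : functor C) (d : nat_trans F G) (e : nat_trans G H) :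
  nt_exact d e -> exists c : nat_trans F (ker_functor e),
    nt_epi c /\ forall p x, ker_functor_incl e p (c p x) = d p x.
Proof.
move=> de.
have dk p x : exists y, ker_incl (e p) y = d p x.
  by apply: ker_lift; apply/de; exists x.
pose c p x := sval (cid (dk p x)).
have cE p x : ker_incl (e p) (c p x) = d p x by rewrite /c; case: cid.
have cB p : zmod_morphism (c p).
  by move=> x y; apply: (@ker_incl_inj _ _ (e p)); rewrite raddfB !cE raddfB.
have cN (p q : C) (le_pq : (p <= q)%O) x :
    mk_additive (cB q) (fmap F le_pq x) =
    fmap (ker_functor e) le_pq (mk_additive (cB p) x).
  apply: (@ker_incl_inj _ _ (e q)); rewrite [LHS]cE nt_natural -cE.
  by rewrite -(nt_natural (ker_functor_incl e)).
exists (@NatTrans _ _ F (ker_functor e) (fun p => mk_additive (cB p)) cN).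
split=> // p y.
have /de[x xE] := ker_inclP y.
by exists x; apply: (@ker_incl_inj _ _ (e p)); rewrite [LHS]cE.
Qed.

Lemma ker_functor_exact (G H : functor C) (e : nat_trans G H) :
  nt_exact (ker_functor_incl e) e.
Proof. by move=> p y; split=> [/ker_lift//|[x <-]]; exact: ker_inclP. Qed.

End Acyclicity.

Theorem theorem7 (disp : Order.disp_t) (C : porderType disp) (deg : C -> int)
    (hgraded : graded_poset deg) (hbounded : bounded_below deg)
    (H : functor C) (hH : pseudo_projective deg H) :
  colim_acyclic H.
Proof.
have [lb lbP] := hbounded.
move=> P [//|n] _ z.
have hP m := projective_pseudo_projective hgraded (@res_projective _ _ H P m).
(* [Z] is the [n]-th syzygy: [H] for [n = 0], and then the kernel of the previous [e], to which
   [ker_pseudo_projective] applies. *)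
have [Z [e [hZ e_epi e_exact]]] : exists (Z : functor C) (e : nat_trans (P n) Z),
    [/\ pseudo_projective deg Z, nt_epi e & nt_exact (res_d P n) e].
  elim: n {z} => [|n [Z [e [hZ e_epi e_exact]]]].
    by exists H, (res_aug P); split=> //; [exact: res_aug_epi|exact: res_exact0].
  have [c [c_epi cE]] := corestrict e_exact.
  exists (ker_functor e), c; split=> // [|p y].
    exact: (ker_pseudo_projective (f := ker_functor_incl e) hgraded lbP
      (fun p => @ker_incl_inj _ _ (e p))
      (ker_functor_exact e) e_epi hZ (hP n)).
  rewrite -res_exact -cE; split=> [->|y0]; first exact: raddf0.
  by apply: (@ker_incl_inj _ _ (e p)); rewrite [LHS]y0 raddf0.
have [c [c_epi cE]] := corestrict e_exact.
have c_exact : nt_exact (res_d P n.+1) c.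
  move=> p y; rewrite -res_exact -cE; split=> [->|y0]; first exact: raddf0.
  by apply: (@ker_incl_inj _ _ (e p)); rewrite [LHS]y0 raddf0.
have [w <-] := quot_pi_surj z; apply/quot_pi_eq0; apply: mem_generated.
(* By right exactness of the colimit, the cycle [w] is a boundary once [c] kills it. *)
suff : colim_map c (ker_incl _ w) = 0.
  by move=> /(colim_right_exact c_exact c_epi)[x xE]; exists x.
(* The colimit of the kernel of [e] embeds in that of [P n], where [w] goes to its image under the
   differential, which is zero. *)
apply: (colim_map_injective (f := ker_functor_incl e) hgraded lbP
  (fun p => @ker_incl_inj _ _ (e p))
  (ker_functor_exact e) e_epi hZ (hP n)).
rewrite -[RHS](ker_inclP w).
have [D <-] := colim_sum_surj (ker_incl _ w); rewrite !colim_map_sum.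
congr (colim_sum _ _); apply: dproj_inj => p; rewrite !dproj_dmap; exact: cE.
Qed.
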